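(* Let $a\in A(\mathbb{T})$ and $b\in A(\mathbb{T})$ be real nonconstant functions. Assume that $b$ is linear on some interval; that is, there are a nonempty open interval $J\subseteq[-\pi,\pi]$ and real numbers $p\neq 0$, $q$ such that $b(y)=py+q$ for all $y\in J$. Let $\varphi$ be the function on $\mathbb{T}^2$ given by $\varphi(x,y)=a(x)b(y)$, $x\in\mathbb{T}$, $y\in\mathbb{T}$. Then $$\|e^{i\lambda\varphi}\|_{A(\mathbb{T}^2)}\gtrsim|\lambda|,\qquad\lambda\in\mathbb{R},\ |\lambda|\to\infty;$$ that is, there exist constants $c>0$ and $\lambda_0>0$, independent of $\lambda$, such that $\|e^{i\lambda\varphi}\|_{A(\mathbb{T}^2)}\geq c|\lambda|$ for all $\lambda\in\mathbb{R}$ with $|\lambda|\geq\lambda_0$.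
   Context: $\mathbb{T}^d=\mathbb{R}^d/(2\pi\mathbb{Z})^d$, $\mathbb{T}=\mathbb{T}^1$; functions on $\mathbb{T}^d$ are identified with functions on $\mathbb{R}^d$ that are $2\pi$-periodic in each variable. For a function $f$ on $\mathbb{T}^d$, $\widehat f(n)=\frac{1}{(2\pi)^d}\int_{\mathbb{T}^d}f(t)e^{-i(n,t)}\,dt$, $n\in\mathbb{Z}^d$, where $(\cdot,\cdot)$ is the Euclidean inner product. $A(\mathbb{T}^d)$ is the space of all continuous (complex-valued) functions $f$ on $\mathbb{T}^d$ with $\|f\|_{A(\mathbb{T}^d)}=\sum_{n\in\mathbb{Z}^d}|\widehat f(n)|<\infty$; it is a Banach algebra under pointwise multiplication. *)

(* Defs.v *)
From HB Require Import structures.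
From mathcomp Require Import all_boot all_order all_algebra.
From mathcomp Require Import complex.
From mathcomp Require Import all_classical all_reals all_analysis.
Set Implicit Arguments.
Unset Strict Implicit.
Unset Printing Implicit Defensive.
Import Order.TTheory GRing.Theory Num.Theory.
Import numFieldNormedType.Exports.
Local Open Scope classical_set_scope.
Local Open Scope ring_scope.
Local Open Scope complex_scope.

Section fourier.
Context {R : realType}.

(* e^{it} for real t *)
Definition expi (t : R) : R[i] := cos t +i* sin t.

Definition cintegral d (T : measurableType d)
    (mu : {measure set T -> \bar R}) (D : set T) (f : T -> R[i]) : R[i] :=
  (\int[mu]_(x in D) complex.Re (f x)) +i* (\int[mu]_(x in D) complex.Im (f x)).

(* Functions on the torus T^d (d = 1, 2) are functions on R^d that are
   2pi-periodic in each variable; the cube [-pi, pi]^d is used as a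
   fundamental domain, its boundary being negligible. *)
Definition fourier_coef1 (f : R -> R[i]) (n : int) : R[i] :=
  ((2 * pi)^-1)%:C *
  cintegral lebesgue_measure `[- pi, pi]
    (fun t : R => f t * expi (- (n%:~R * t))).

Definition fourier_coef2 (f : R * R -> R[i]) (n : int * int) : R[i] :=
  ((2 * pi) ^- 2)%:C *
  cintegral (lebesgue_measure \x lebesgue_measure)%E
    (`[- pi, pi] `*` `[- pi, pi])
    (fun t : R * R => f t * expi (- (n.1%:~R * t.1 + n.2%:~R * t.2))).

(* The norms take values in [0, +oo]: they are finite exactly when the
   Fourier series converges absolutely. *)
Definition A_norm1 (f : R -> R[i]) : \bar R :=
  \esum_(n in [set: int]) (Normc.normc (fourier_coef1 f n))%:E.

Definition A_norm2 (f : R * R -> R[i]) : \bar R :=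
  \esum_(n in [set: int * int]) (Normc.normc (fourier_coef2 f n))%:E.

(* The regular algebra R[i]^o carries the topology of the modulus. *)
Definition in_A1 (f : R -> R[i]) : Prop :=
  [/\ periodic f (2 * pi),
      continuous (f : R -> R[i]^o) &
      (A_norm1 f < +oo)%E].

End fourier.

(* Main.v *)
Require Import Defs.
From HB Require Import structures.
From mathcomp Require Import all_boot all_order all_algebra.
From mathcomp Require Import complex.
From mathcomp Require Import all_classical all_reals all_analysis.
From mathcomp Require Import measurable_realfun zify ring lra.
Import Order.TTheory GRing.Theory Num.Theory.
Import numFieldNormedType.Exports.
Local Open Scope classical_set_scope.
Local Open Scope ring_scope.
Local Open Scope complex_scope.

(** Bounds from below for the Wiener norm come from duality: a finite sum
    [\sum_i c i * f (z i)] is at most the norm of [f] times the supremum of the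
    same sum over the waves [expi (m * x + n * y)] ([fourier_dual]). So one needs
    points and weights on which [expi (lambda * a x * b y)] is large while every
    wave is small.

    Where [b y = p * y + q], the function is, for fixed [x], a pure oscillation in
    [y] of frequency [lambda * p * a x]. As [a] is continuous and not constant, its
    values fill an interval; hence there are points [x j], for [j < N] with [N]
    comparable to [|lambda|], at which these frequencies form an arithmetic
    progression spread over an interval of length comparable to [|lambda|]. Sampling
    [y] along an arithmetic progression in the interval of linearity with the
    step adapted to this one turns the restriction of the function to the grid
    into the matrix of the discrete Fourier transform of order [N]. A single wave
    has only one frequency in [y], so it can correlate with about one of the [N]
    rows, whatever its phases at the points [x j]. Fejer weights in [y] make the
    correlations nonnegative, and Parseval on the cyclic group of order [N] then
    bounds their sum exactly: the functional is [N ^ 3] on the function and at most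
    [N ^ 2] on waves ([A_norm2_ge_grid]), whence a norm of at least [N].

    Duality requires Fourier inversion at the points of the grid. It is obtained
    from Fejer means: these are finite combinations of waves with coefficients
    controlled by those of [f] ([cfejer_meanE], [sum_freq_coef_le]), and they
    converge to [f] at interior points of continuity ([fejer_mean_near]). *)

(** * The circle and the Fejer kernel *)

Section expi_theory.
Context {R : realType}.
Implicit Types s t x : R.

Lemma expi0 : expi 0 = 1 :> R[i].
Proof. by rewrite /expi cos0 sin0. Qed.

Lemma expiD s t : expi (s + t) = expi s * expi t.
Proof. by rewrite /expi cosD sinD; simpc; rewrite addrC (addrC (sin s * _)). Qed.

Lemma conjc_expi t : (expi t)^* = expi (- t).
Proof. by rewrite /expi cosN sinN. Qed.

Lemma expiVN t : expi t * expi (- t) = 1.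
Proof. by rewrite -expiD subrr expi0. Qed.

Lemma norm_expi t : `|expi t| = 1.
Proof. by rewrite normc_def /= cos2Dsin2 sqrtr1. Qed.

Lemma expi_natM n t : expi (n%:R * t) = expi t ^+ n.
Proof.
elim: n => [|n IHn]; first by rewrite mul0r expi0.
by rewrite -natr1 mulrDl mul1r expiD IHn exprSr.
Qed.

Lemma expi_2pi (n : int) : expi (n%:~R * (2 * pi)) = 1 :> R[i].
Proof.
have e2pi : expi (2 * pi) = 1 :> R[i].
  by rewrite mulrC mulr_natr /expi cos2pi sin2pi.
case: n => n; first by rewrite expi_natM e2pi expr1n.
by rewrite NegzE rmorphN mulNr -conjc_expi expi_natM e2pi expr1n conjc1.
Qed.

(** Both kernels of the proof, the averaging kernel of the Fourier inversion and
    the weights of the extremal grid, come from this expansion: the square makes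
    them nonnegative, while the right-hand side shows their frequencies, which
    are indexed by pairs so that no multiplicity has to be computed. *)
Lemma sqr_norm_sum_expi M t :
  `|\sum_(k < M) expi (k%:R * t)| ^+ 2 =
  \sum_(k < M) \sum_(l < M) expi ((k%:Z - l%:Z)%:~R * t).
Proof.
rewrite sqr_normc rmorph_sum mulr_suml; apply: eq_bigr => k _.
rewrite mulr_sumr; apply: eq_bigr => l _.
by rewrite [X in _ * X]conjc_expi -expiD intrB mulrBl.
Qed.

End expi_theory.

Section fejer_kernel.
Context {R : realType}.
Implicit Types (M : nat) (t : R).

(** The Fejer kernel of mass [2 * pi] and order [M], whose usual coefficients
    [1 - |n| / M] are the numbers of pairs [(k, l)] with [k - l = n], divided
    by [M]. *)
Definition fejer M t : R :=
  M%:R^-1 * \sum_(k < M) \sum_(l < M) cos ((k%:Z - l%:Z)%:~R * t).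

Lemma sqr_norm_sum_expi_real M t :
  (\sum_(k < M) \sum_(l < M) cos ((k%:Z - l%:Z)%:~R * t))%:C =
  `|\sum_(k < M) expi (k%:R * t)| ^+ 2.
Proof.
have -> : `|\sum_(k < M) expi (k%:R * t)| ^+ 2 =
          (complex.Re (`|\sum_(k < M) expi (k%:R * t)| ^+ 2))%:C.
  by rewrite RRe_real// realX// normr_real.
apply: congr1; rewrite sqr_norm_sum_expi.
rewrite [RHS](raddf_sum (@complex.Re R : Rcomplex R -> R)); apply: eq_bigr => k _.
by rewrite [RHS](raddf_sum (@complex.Re R : Rcomplex R -> R)).
Qed.

Lemma fejer_expi M t :
  (fejer M t)%:C =
  M%:R^-1 * \sum_(k < M) \sum_(l < M) expi ((k%:Z - l%:Z)%:~R * t).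
Proof.
by rewrite rmorphM /= sqr_norm_sum_expi_real sqr_norm_sum_expi fmorphV rmorph_nat.
Qed.

Lemma fejer_ge0 M t : 0 <= fejer M t.
Proof.
rewrite mulr_ge0 ?invr_ge0 ?ler0n// -lecR sqr_norm_sum_expi_real.
by rewrite exprn_ge0.
Qed.

(** Quantitative concentration at [0]. Multiplying the geometric sum by
    [1 - expi t] telescopes it to a difference of two unimodular numbers, and
    [2 * (1 - cos t)] is the squared modulus of [1 - expi t]. In this product
    form no distance to the lattice of periods appears. *)
Lemma fejer_decay M t : (1 - cos t) * fejer M t <= 2 / M%:R.
Proof.
rewrite /fejer mulrCA mulrC ler_wpM2r ?invr_ge0 ?ler0n//.
suff : (2 * (1 - cos t))%:C * (\sum_(k < M) \sum_(l < M)
     cos ((k%:Z - l%:Z)%:~R * t))%:C <= 4%:R%:C :> R[i].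
  by rewrite -rmorphM lecR -mulrA; lra.
have -> : (2 * (1 - cos t))%:C = `|1 - expi t| ^+ 2.
  rewrite sqr_normc /expi; simpc.
  have := cos2Dsin2 t; set c := cos t; set s := sin t => cs.
  apply/eqP; rewrite eq_complex /=; apply/andP; split; apply/eqP; last by ring.
  by nra.
rewrite sqr_norm_sum_expi_real -exprMn -normrM.
have -> : (1 - expi t) * \sum_(k < M) expi (k%:R * t) = 1 - expi (M%:R * t).
  under eq_bigr do rewrite expi_natM.
  by rewrite expi_natM -opprB -[RHS]opprB subrX1 mulNr.
have -> : 4%:R%:C = (1 + 1) ^+ 2 :> R[i] by rewrite rmorph_nat; ring.
have le2 : `|1 - expi (M%:R * t)| <= 1 + 1 :> R[i].
  by apply: le_trans (ler_normB _ _) _; rewrite normr1 norm_expi.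
by rewrite lerXn2r// nnegrE// addr_ge0.
Qed.

End fejer_kernel.

(** * Integrals over the fundamental domain *)

Local Notation lam := (@lebesgue_measure _).
Local Notation lam2 := ((@lebesgue_measure _) \x (@lebesgue_measure _))%E.
Local Notation square := (`[- pi, pi]%classic `*` `[- pi, pi]%classic).

Section integral_tools.
Context {R : realType}.

Lemma Rintegral_sum d (T : measurableType d) (mu : {measure set T -> \bar R})
    (D : set T) (I : Type) (r : seq I) (f : I -> T -> R) :
  measurable D -> (forall i, mu.-integrable D (EFin \o f i)) ->
  \int[mu]_(x in D) (\sum_(i <- r) f i x) =
  \sum_(i <- r) \int[mu]_(x in D) f i x.
Proof.
move=> mD intf; elim: r => [|i r IHr].
  rewrite big_nil; under eq_Rintegral do rewrite big_nil.
  by rewrite Rintegral_cst// mul0r.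
rewrite big_cons -IHr -RintegralD//.
  by apply: eq_Rintegral => x _; rewrite big_cons.
have -> : EFin \o (fun x => \sum_(j <- r) f j x) =
          (fun x => (\sum_(j <- r) (f j x)%:E)%E).
  by apply/funext => x /=; rewrite sumEFin.
by apply: (@integrable_sum _ _ _ _ _ _ _ r xpredT) => // j _; exact: intf.
Qed.

Lemma continuous_integrable_pi (f : R -> R) : continuous f ->
  lam.-integrable `[- pi, pi] (EFin \o f).
Proof.
move=> cf; apply: continuous_compact_integrable; first exact: segment_compact.
exact: continuous_subspaceT.
Qed.

Lemma lebesgue_measure_pi : lam (`[- pi, pi]%classic : set R) = (2 * pi)%:E.
Proof.
rewrite lebesgue_measure_itv /= lte_fin ifT ?gtrN ?pi_gt0// -EFinD.
by congr EFin; ring.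
Qed.

Lemma continuous_sum (I : Type) (r : seq I) (f : I -> R -> R) :
  (forall i, continuous (f i)) -> continuous (fun s => \sum_(i <- r) f i s).
Proof. by move=> cf; apply: continuous_big => //; exact: add_continuous. Qed.

Lemma continuous_cosM (c x : R) : continuous (fun s : R => cos (c * (x - s))).
Proof.
move=> s; apply: continuous_comp; last exact: continuous_cos.
by apply: cvgM; [exact: cvg_cst|apply: cvgB; [exact: cvg_cst|exact: cvg_id]].
Qed.

Lemma integral_cosM (n : int) (x : R) :
  \int[lam]_(s in `[- pi, pi]) cos (n%:~R * (x - s)) =
  if n == 0 then 2 * pi else 0.
Proof.
have pi0 := @pi_gt0 R.
have [->|n0] := eqVneq n 0.
  under eq_Rintegral do rewrite mul0r cos0.
  by rewrite Rintegral_cst// mul1r (congr1 fine lebesgue_measure_pi).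
have n0' : n%:~R != 0 :> R by rewrite intr_eq0.
pose F (s : R) : R := - (n%:~R^-1 * sin (n%:~R * (x - s))).
have dF (s : R) : is_derive s 1 F (cos (n%:~R * (x - s))).
  rewrite /F; apply: is_derive_eq; rewrite /GRing.scale /=.
  by field.
have cF : continuous F.
  move=> s; apply/differentiable_continuous/derivable1_diffP.
  exact: ex_derive.
rewrite /Rintegral (@continuous_FTC2 _ _ F)//.
- rewrite -EFinB /= /F.
  have -> : sin (n%:~R * (x - - pi)) = sin (n%:~R * (x - pi)).
    have -> : n%:~R * (x - - pi) = n%:~R * (x - pi) + n%:~R * (2 * pi) by ring.
    have := expiD (n%:~R * (x - pi)) (n%:~R * (2 * pi)).
    by rewrite expi_2pi mulr1 => -[].
  by rewrite subrr.
- by rewrite gtrN.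
- exact/continuous_subspaceT/continuous_cosM.
- split.
  + by move=> s _; exact: ex_derive.
  + exact/cvg_at_right_filter/cF.
  + exact/cvg_at_left_filter/cF.
- by move=> s _; rewrite derive1E; apply: derive_val.
Qed.

Lemma continuous_fejer M (x : R) : continuous (fun s => fejer M (x - s)).
Proof.
move=> s; apply: cvgM; first exact: cvg_cst.
by do 2 (apply: continuous_sum => ?); exact: continuous_cosM.
Qed.

Lemma integral_fejer M (x : R) : (0 < M)%N ->
  \int[lam]_(s in `[- pi, pi]) fejer M (x - s) = 2 * pi.
Proof.
move=> M0; rewrite RintegralZl//; last first.
  apply: continuous_integrable_pi.
  by do 2 (apply: continuous_sum => ?); exact: continuous_cosM.
rewrite Rintegral_sum//; last first.
  move=> k; apply: continuous_integrable_pi.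
  by apply: continuous_sum => ?; exact: continuous_cosM.
under eq_bigr => k _.
  rewrite Rintegral_sum//; last first.
    by move=> l; apply: continuous_integrable_pi; exact: continuous_cosM.
  under eq_bigr => l _ do rewrite integral_cosM.
  rewrite (bigD1 k)//= subrr eqxx big1 ?addr0; last first.
    by move=> l lk; rewrite subr_eq0 eqz_nat eq_sym [_ == _](negbTE lk).
  over.
by rewrite sumr_const card_ord -[2 * pi *+ M]mulr_natl mulKf// pnatr_eq0 -lt0n.
Qed.

End integral_tools.

Section square_integrals.
Context {R : realType}.

Lemma measurable_square : measurable (square : set (measurableTypeR R * measurableTypeR R)).
Proof. by apply: measurableX; exact: measurable_itv. Qed.

Lemma square_measure :
  lam2 (square : set (measurableTypeR R * measurableTypeR R)) = ((2 * pi) ^+ 2)%:E.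
Proof.
rewrite product_measure1E; [|exact: measurable_itv..].
transitivity ((2 * pi)%:E * (2 * pi)%:E : \bar R)%E; last by rewrite -EFinM expr2.
by congr (_ * _)%E; exact: lebesgue_measure_pi.
Qed.

Lemma bounded_integrable_square (f : measurableTypeR R * measurableTypeR R -> R) (C : R) :
  measurable_fun setT f -> (forall z, `|f z| <= C) ->
  lam2.-integrable square (EFin \o f).
Proof.
move=> mf fC; apply: measurable_bounded_integrable.
- exact: measurable_square.
- by rewrite (_ : _ square = ((2 * pi) ^+ 2)%:E) ?ltry//; exact: square_measure.
- exact: measurable_funS mf.
- by exists C; split; [exact: num_real|move=> y Cy z _; exact: le_trans (fC z) (ltW Cy)].
Qed.

Lemma Rintegral_square_prod (f g : R -> R) :
  continuous f -> continuous g -> (forall s, 0 <= f s) -> (forall s, 0 <= g s) ->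
  \int[lam2]_(z in square) (f z.1 * g z.2) =
  (\int[lam]_(s in `[- pi, pi]) f s) * (\int[lam]_(s in `[- pi, pi]) g s).
Proof.
move=> cf cg f0 g0.
pose I : set R := `[- pi, pi]%classic.
have mI : measurable (I : set (measurableTypeR R)) by exact: measurable_itv.
have mf := continuous_measurable_fun cf.
have mg := continuous_measurable_fun cg.
have mfI : measurable_fun (setT : set (measurableTypeR R)) (f \_ I).
  by apply/(measurable_restrictT _ mI); exact: measurable_funS mf.
have mgI : measurable_fun (setT : set (measurableTypeR R)) (g \_ I).
  by apply/(measurable_restrictT _ mI); exact: measurable_funS mg.
rewrite [LHS]Rintegral_mkcond [X in _ = X * _]Rintegral_mkcond
  [X in _ = _ * X]Rintegral_mkcond.
have fI0 s : 0 <= (f \_ I) s by rewrite patchE; case: ifP.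
have gI0 s : 0 <= (g \_ I) s by rewrite patchE; case: ifP.
have finI (h : R -> R) : continuous h ->
    (\int[lam]_s ((h \_ I) s)%:E)%E \is a fin_num.
  move=> ch; have /(integrable_fin_num mI) := continuous_integrable_pi _ ch.
  rewrite integral_mkcond.
  by under eq_integral do rewrite -[(_ \o _)]/(EFin \o h) restrict_EFin.
rewrite /Rintegral -fineM ?finI//; congr fine.
transitivity (\int[lam2]_z ((f \_ I) z.1 * (g \_ I) z.2)%:E)%E.
  apply: eq_integral => -[s t] _ /=; congr EFin.
  rewrite !patchE in_setX /= -[point]/(0 : R).
  by case: (s \in _); case: (t \in _); rewrite /= ?mul0r ?mulr0.
rewrite fubini_tonelli1; last 2 first.
- apply/measurable_EFinP; apply: measurable_funM.
    by apply: measurableT_comp; [exact: mfI|exact: measurable_fst].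
  by apply: measurableT_comp; [exact: mgI|exact: measurable_snd].
- by move=> z; rewrite lee_fin mulr_ge0.
rewrite /fubini_F /=.
under eq_integral => s _.
  under eq_integral do rewrite EFinM.
  rewrite ge0_integralZl//; first over.
  - exact/measurable_EFinP.
  - by move=> t _; rewrite lee_fin.
  - by rewrite lee_fin.
rewrite ge0_integralZr//.
- exact/measurable_EFinP.
- by move=> s _; rewrite lee_fin.
- by apply: integral_ge0 => t _; rewrite lee_fin.
Qed.

End square_integrals.

(** * Fejer means of a real function *)

Section fejer_means.
Context {R : realType}.
Notation plane := (measurableTypeR R * measurableTypeR R)%type.

Lemma fejer_le M (t : R) : fejer M t <= M%:R.
Proof.
have [->|M0] := posnP M; first by rewrite /fejer big_ord0 mulr0.
rewrite /fejer ler_pdivrMl ?ltr0n//.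
apply: (@le_trans _ _ (\sum_(k < M) \sum_(l < M) (1 : R))).
  by do 2 (apply: ler_sum => ? _); exact: cos_le1.
by under eq_bigr do rewrite sumr_const card_ord; rewrite sumr_const card_ord mulr_natl.
Qed.

(** For a point inside the fundamental domain and another one in its closure the
    difference of coordinates may approach [2 * pi] but not reach it, so the
    cosine has to be controlled on both sides of [pi]. *)
Lemma cos_le_cos (d t : R) : 0 < d -> d <= `|t| -> `|t| <= 2 * pi - d ->
  cos t <= cos d.
Proof.
move=> d0 dt td; have pi0 := @pi_gt0 R.
have dpi : d \in `[0, pi] by rewrite in_itv /=; lra.
have mono (u : R) : u \in `[0, pi] -> d <= u -> cos u <= cos d.
  move=> ui; rewrite le_eqVlt => /predU1P[->//|du].
  by rewrite ltW// ltr_cos.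
rewrite -cos_norm; case: (lerP `|t| pi) => tpi.
  by apply: mono; rewrite // in_itv /= normr_ge0.
have -> : cos `|t| = cos (2 * pi - `|t|).
  rewrite -[RHS]cosN opprB -[RHS]cosD2pi; congr cos.
  by rewrite -[pi *+ 2]mulr_natl subrK.
by apply: mono; rewrite ?in_itv /=; lra.
Qed.

Lemma one_sub_cos_gt0 (d : R) : 0 < d -> d <= pi -> 0 < 1 - cos d.
Proof.
move=> d0 dpi; rewrite subr_gt0 -cos0 ltr_cos// in_itv /= ?lexx ?pi_ge0//.
by rewrite ltW.
Qed.

Definition fejer2 M (z w : plane) : R := fejer M (z.1 - w.1) * fejer M (z.2 - w.2).

Definition fejer_mean M (g : plane -> R) (z : plane) : R :=
  (2 * pi) ^- 2 * \int[lam2]_(w in square) (g w * fejer2 M z w).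

Lemma measurable_fejer_fst M (x : R) :
  measurable_fun (setT : set plane) (fun w => fejer M (x - w.1)).
Proof.
apply: (@measurableT_comp _ _ _ _ _ _ (fun s : R => fejer M (x - s))).
  exact: (continuous_measurable_fun (continuous_fejer M x)).
exact: measurable_fst.
Qed.

Lemma measurable_fejer_snd M (y : R) :
  measurable_fun (setT : set plane) (fun w => fejer M (y - w.2)).
Proof.
apply: (@measurableT_comp _ _ _ _ _ _ (fun s : R => fejer M (y - s))).
  exact: (continuous_measurable_fun (continuous_fejer M y)).
exact: measurable_snd.
Qed.

Lemma measurable_fejer2 M (z : plane) : measurable_fun setT (fejer2 M z).
Proof.
by apply: measurable_funM; [exact: measurable_fejer_fst|exact: measurable_fejer_snd].
Qed.

Lemma fejer2_ge0 M z w : 0 <= fejer2 M z w.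
Proof. by rewrite mulr_ge0 ?fejer_ge0. Qed.

Lemma fejer2_le M z w : fejer2 M z w <= M%:R ^+ 2.
Proof. by rewrite expr2 ler_pM ?fejer_ge0 ?fejer_le. Qed.

Lemma integrable_fejer2 M z (h : plane -> R) (C : R) :
  measurable_fun setT h -> (forall w, `|h w| <= C) ->
  lam2.-integrable square (EFin \o (fun w => h w * fejer2 M z w)).
Proof.
move=> mh hC; apply: (@bounded_integrable_square _ _ (C * M%:R ^+ 2)).
  by apply: measurable_funM => //; exact: measurable_fejer2.
move=> w; rewrite normrM ler_pM//.
by rewrite ger0_norm ?fejer2_ge0 ?fejer2_le.
Qed.

Lemma integral_fejer2 M z : (0 < M)%N ->
  \int[lam2]_(w in square) fejer2 M z w = (2 * pi) ^+ 2.
Proof.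
move=> M0; rewrite (@Rintegral_square_prod _ (fun s => fejer M (z.1 - s))
  (fun t => fejer M (z.2 - t))); do ?exact: continuous_fejer.
- by rewrite !integral_fejer// expr2.
- by move=> s; exact: fejer_ge0.
- by move=> s; exact: fejer_ge0.
Qed.

Lemma integral_fejer_marginal1 M (x : R) : (0 < M)%N ->
  \int[lam2]_(w in square) fejer M (x - w.1) = (2 * pi) ^+ 2.
Proof.
move=> M0; under eq_Rintegral do rewrite -[fejer _ _]mulr1.
rewrite (@Rintegral_square_prod _ (fun s => fejer M (x - s)) (fun=> 1)) //.
- rewrite integral_fejer// Rintegral_cst// mul1r.
  by rewrite (congr1 fine lebesgue_measure_pi) expr2.
- exact: continuous_fejer.
- by move=> s; exact: cvg_cst.
- by move=> s; exact: fejer_ge0.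
Qed.

Lemma integral_fejer_marginal2 M (y : R) : (0 < M)%N ->
  \int[lam2]_(w in square) fejer M (y - w.2) = (2 * pi) ^+ 2.
Proof.
move=> M0; under eq_Rintegral do rewrite -[fejer _ _]mul1r.
rewrite (@Rintegral_square_prod _ (fun=> 1) (fun s => fejer M (y - s))) //.
- rewrite integral_fejer// Rintegral_cst// mul1r.
  by rewrite (congr1 fine lebesgue_measure_pi) expr2.
- by move=> s; exact: cvg_cst.
- exact: continuous_fejer.
- by move=> s; exact: fejer_ge0.
Qed.

(** Convergence of the Fejer means at a point of continuity inside the square.
    The variation of [g] satisfies
    [|g w - g z| <= e + K * (1 - cos (z.1 - w.1)) + K * (1 - cos (z.2 - w.2))]:
    near [z] the first term suffices, and far from [z] one of the other two
    exceeds the trivial bound [2]. Multiplied by the kernel, these two terms are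
    [O(1 / M)] by [fejer_decay], so the domain of integration is never split.
    Restricting to interior points avoids periodizing the function. *)
Lemma fejer_mean_near (g : plane -> R) (z : plane) (e d : R) :
  measurable_fun setT g -> (forall w, `|g w| <= 1) ->
  `|z.1| < pi -> `|z.2| < pi -> 0 < e -> 0 < d ->
  (forall w : plane, `|z.1 - w.1| < d -> `|z.2 - w.2| < d -> `|g w - g z| <= e) ->
  exists K : R, forall M, (0 < M)%N -> `|fejer_mean M g z - g z| <= e + K / M%:R.
Proof.
move=> mg g1 xpi ypi e0 d0 gd; have pi0 := @pi_gt0 R.
(* The last two terms keep [|z.1 - w.1|] and [|z.2 - w.2|] at most
   [2 * pi - r] on the square. *)
pose r := Num.min d (Num.min (pi - `|z.1|) (pi - `|z.2|)).
have r0 : 0 < r by rewrite !lt_min d0 !subr_gt0 xpi ypi.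
have rd : r <= d by rewrite ge_min lexx.
have rx : r <= pi - `|z.1| by rewrite !ge_min lexx orbT.
have ry : r <= pi - `|z.2| by rewrite !ge_min lexx !orbT.
have c0 : 0 < 1 - cos r.
  apply: one_sub_cos_gt0 => //; apply: le_trans rx _.
  by rewrite lerBlDr lerDl.
pose K := 2 / (1 - cos r).
have K0 : 0 <= K by rewrite divr_ge0// ltW.
have far (x s : R) : r <= pi - `|x| -> `|s| <= pi -> r <= `|x - s| ->
    2 <= K * (1 - cos (x - s)).
  move=> rx' spi rxs.
  apply: (@le_trans _ _ (K * (1 - cos r))); first by rewrite /K divfK// gt_eqF.
  rewrite ler_wpM2l// lerB// cos_le_cos//.
  by have := ler_normB x s; lra.
have near_far (w : plane) : square w ->
    `|g w - g z| <= e + K * (1 - cos (z.1 - w.1)) + K * (1 - cos (z.2 - w.2)).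
  move=> [/= w1 w2].
  have {}w1 : `|w.1| <= pi by move: w1; rewrite /= in_itv /= ler_norml.
  have {}w2 : `|w.2| <= pi by move: w2; rewrite /= in_itv /= ler_norml.
  have K1 t : 0 <= K * (1 - cos t) by rewrite mulr_ge0// subr_ge0 cos_le1.
  have g2 : `|g w - g z| <= 2.
    by apply: le_trans (ler_normB _ _) _; have := (g1 w, g1 z); case; lra.
  have := K1 (z.1 - w.1); have := K1 (z.2 - w.2).
  case: (ltP `|z.1 - w.1| r) => [near1|far1]; last first.
    by have := far _ _ rx w1 far1; lra.
  case: (ltP `|z.2 - w.2| r) => [near2|far2]; last first.
    by have := far _ _ ry w2 far2; lra.
  by have := gd w (lt_le_trans near1 rd) (lt_le_trans near2 rd); lra.
exists (4 * K) => M M0.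
have M0' : 0 < M%:R :> R by rewrite ltr0n.
have pi2 : 0 < (2 * pi) ^+ 2 :> R by rewrite exprn_gt0// mulr_gt0.
have mzg : measurable_fun (setT : set plane) (fun w => g w - g z).
  by apply: measurable_funB.
have bzg (w : plane) : `|g w - g z| <= 2.
  by apply: le_trans (ler_normB _ _) _; have := (g1 w, g1 z); case; lra.
have -> : fejer_mean M g z - g z =
    (2 * pi) ^- 2 * \int[lam2]_(w in square) ((g w - g z) * fejer2 M z w).
  under [in RHS]eq_Rintegral do rewrite mulrBl.
  rewrite RintegralB; last 3 first.
  - exact: measurable_square.
  - exact: integrable_fejer2 g1.
  - by apply: (@integrable_fejer2 _ _ (cst (g z)) `|g z|).
  rewrite (@RintegralZl _ _ _ _ _ (fejer2 M z)); last 2 first.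
  - exact: measurable_square.
  - apply: (@bounded_integrable_square _ _ (M%:R ^+ 2)) => //.
      exact: measurable_fejer2.
    by move=> w; rewrite ger0_norm ?fejer2_ge0 ?fejer2_le.
  rewrite integral_fejer2// mulrBr [_ * (g z * _)]mulrCA mulVf ?mulr1//.
  by rewrite gt_eqF.
rewrite normrM ger0_norm; last by rewrite invr_ge0 ltW.
rewrite ler_pdivrMl//.
apply: le_trans (le_normr_Rintegral _ _) _.
- exact: measurable_square.
- exact: integrable_fejer2 bzg.
pose B w := e * fejer2 M z w + (K * (2 / M%:R)) *
  (fejer M (z.1 - w.1) + fejer M (z.2 - w.2)).
have int1 : lam2.-integrable square (EFin \o (fun w : plane => fejer M (z.1 - w.1))).
  apply: (@bounded_integrable_square _ _ M%:R); first exact: measurable_fejer_fst.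
  by move=> w; rewrite ger0_norm ?fejer_ge0 ?fejer_le.
have int2 : lam2.-integrable square (EFin \o (fun w : plane => fejer M (z.2 - w.2))).
  apply: (@bounded_integrable_square _ _ M%:R); first exact: measurable_fejer_snd.
  by move=> w; rewrite ger0_norm ?fejer_ge0 ?fejer_le.
have int0 : lam2.-integrable square (EFin \o (fejer2 M z)).
  apply: (@bounded_integrable_square _ _ (M%:R ^+ 2)); first exact: measurable_fejer2.
  by move=> w; rewrite ger0_norm ?fejer2_ge0 ?fejer2_le.
have int12 : lam2.-integrable square (EFin \o (fun w : plane =>
    fejer M (z.1 - w.1) + fejer M (z.2 - w.2))).
  exact: (integrableD measurable_square int1 int2).
have intB0 : lam2.-integrable square (EFin \o (fun w => e * fejer2 M z w)).
  exact: (integrableZl measurable_square e int0).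
have intB1 : lam2.-integrable square (EFin \o (fun w : plane =>
    (K * (2 / M%:R)) * (fejer M (z.1 - w.1) + fejer M (z.2 - w.2)))).
  exact: (integrableZl measurable_square (K * (2 / M%:R)) int12).
apply: le_trans (le_Rintegral (f2 := B) _ _ _ _) _.
- exact: measurable_square.
- exact/integrable_norm/(integrable_fejer2 _ _ _ _ _ bzg).
- exact: (integrableD measurable_square intB0 intB1).
- move=> w Qw; rewrite normrM (ger0_norm (fejer2_ge0 _ _ _)).
  apply: le_trans (ler_wpM2r (fejer2_ge0 _ _ _) (near_far _ Qw)) _.
  have h1 : K * fejer M (z.2 - w.2) * ((1 - cos (z.1 - w.1)) * fejer M (z.1 - w.1))
      <= K * fejer M (z.2 - w.2) * (2 / M%:R).
    by rewrite ler_wpM2l ?fejer_decay// mulr_ge0 ?fejer_ge0.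
  have h2 : K * fejer M (z.1 - w.1) * ((1 - cos (z.2 - w.2)) * fejer M (z.2 - w.2))
      <= K * fejer M (z.1 - w.1) * (2 / M%:R).
    by rewrite ler_wpM2l ?fejer_decay// mulr_ge0 ?fejer_ge0.
  by rewrite /B /fejer2; lra.
rewrite RintegralD//; last exact: measurable_square.
rewrite !RintegralZl//; do ?exact: measurable_square.
rewrite RintegralD//; last exact: measurable_square.
rewrite integral_fejer2// integral_fejer_marginal1// integral_fejer_marginal2//.
rewrite le_eqVlt; apply/orP; left; apply/eqP.
by field; rewrite gt_eqF.
Qed.

End fejer_means.

(** * Complex integrals over the square *)

Section complex_integrals.
Context {R : realType}.
Notation plane := (measurableTypeR R * measurableTypeR R)%type.
Implicit Types f g : plane -> R[i].

Definition bounded_measurable (f : plane -> R[i]) := exists C : R,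
  [/\ measurable_fun setT (fun w => complex.Re (f w)),
      measurable_fun setT (fun w => complex.Im (f w)),
      forall w, `|complex.Re (f w)| <= C &
      forall w, `|complex.Im (f w)| <= C].

Lemma bounded_measurable_Re f : bounded_measurable f ->
  lam2.-integrable square (EFin \o (fun w => complex.Re (f w))).
Proof. by case=> C [mf _ fC _]; exact: bounded_integrable_square mf fC. Qed.

Lemma bounded_measurable_Im f : bounded_measurable f ->
  lam2.-integrable square (EFin \o (fun w => complex.Im (f w))).
Proof. by case=> C [_ mf _ fC]; exact: bounded_integrable_square mf fC. Qed.

Lemma bounded_measurableM f g : bounded_measurable f -> bounded_measurable g ->
  bounded_measurable (fun w => f w * g w).
Proof.
move=> [C [mf1 mf2 f1 f2]] [D [mg1 mg2 g1 g2]]; exists (C * D + C * D).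
have mulRe (u v : R[i]) : complex.Re (u * v) =
    complex.Re u * complex.Re v - complex.Im u * complex.Im v by case: u v => ? ? [].
have mulIm (u v : R[i]) : complex.Im (u * v) =
    complex.Re u * complex.Im v + complex.Im u * complex.Re v by case: u v => ? ? [].
split.
- under eq_fun do rewrite mulRe.
  by apply: measurable_funB; apply: measurable_funM.
- under eq_fun do rewrite mulIm.
  by apply: measurable_funD; apply: measurable_funM.
- by move=> w; rewrite mulRe (le_trans (ler_normB _ _))// lerD// normrM ler_pM.
- by move=> w; rewrite mulIm (le_trans (ler_normD _ _))// lerD// normrM ler_pM.
Qed.

Lemma bounded_measurable_expi (u : plane -> R) : measurable_fun setT u ->
  bounded_measurable (fun w => expi (u w)).
Proof.
move=> mu; exists 1; split.
- apply: (@measurableT_comp _ _ _ _ _ _ (@cos R)) => //.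
  by apply: continuous_measurable_fun; exact: continuous_cos.
- apply: (@measurableT_comp _ _ _ _ _ _ (@sin R)) => //.
  by apply: continuous_measurable_fun; exact: continuous_sin.
- by move=> w; exact: cos_max.
- by move=> w; exact: sin_max.
Qed.

Lemma bounded_measurable_cst (c : R[i]) : bounded_measurable (fun=> c).
Proof.
exists (`|complex.Re c| + `|complex.Im c|).
by split => [//|//|_|_]; rewrite ?lerDl ?lerDr.
Qed.

Lemma bounded_measurableD f g : bounded_measurable f -> bounded_measurable g ->
  bounded_measurable (fun w => f w + g w).
Proof.
move=> [C [mf1 mf2 f1 f2]] [D [mg1 mg2 g1 g2]]; exists (C + D).
have addRe (u v : R[i]) : complex.Re (u + v) = complex.Re u + complex.Re v.
  by case: u v => ? ? [].
have addIm (u v : R[i]) : complex.Im (u + v) = complex.Im u + complex.Im v.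
  by case: u v => ? ? [].
split.
- by under eq_fun do rewrite addRe; apply: measurable_funD.
- by under eq_fun do rewrite addIm; apply: measurable_funD.
- by move=> w; rewrite addRe (le_trans (ler_normD _ _))// lerD.
- by move=> w; rewrite addIm (le_trans (ler_normD _ _))// lerD.
Qed.

Lemma bounded_measurable_sumZ (I : Type) (r : seq I) (c : I -> R[i])
    (f : I -> plane -> R[i]) : (forall i, bounded_measurable (f i)) ->
  bounded_measurable (fun w => \sum_(i <- r) c i * f i w).
Proof.
move=> bf; elim: r => [|i r IHr].
  by under eq_fun do rewrite big_nil; exact: bounded_measurable_cst.
under eq_fun do rewrite big_cons.
apply: bounded_measurableD => //; apply: bounded_measurableM => //.
exact: bounded_measurable_cst.
Qed.

Lemma cintegralD f g : bounded_measurable f -> bounded_measurable g ->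
  cintegral lam2 square (fun w => f w + g w) =
  cintegral lam2 square f + cintegral lam2 square g.
Proof.
move=> bf bg; rewrite /cintegral.
have -> (u v s t : R) : (u +i* v) + (s +i* t) = (u + s) +i* (v + t) by [].
congr (_ +i* _); rewrite -[RHS]RintegralD; do ?[exact: measurable_square
  |exact: bounded_measurable_Re|exact: bounded_measurable_Im].
  by apply: eq_Rintegral => w _; case: (f w) (g w) => ? ? [].
by apply: eq_Rintegral => w _; case: (f w) (g w) => ? ? [].
Qed.

Lemma cintegralZ (c : R[i]) f : bounded_measurable f ->
  cintegral lam2 square (fun w => c * f w) = c * cintegral lam2 square f.
Proof.
move=> bf; case: c => a b; rewrite /cintegral.
have -> (u v s t : R) : (u +i* v) * (s +i* t) = (u * s - v * t) +i* (u * t + v * s).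
  by [].
have iRe := bounded_measurable_Re _ bf; have iIm := bounded_measurable_Im _ bf.
have iZ (r : R) h : lam2.-integrable square (EFin \o h) ->
    lam2.-integrable square (EFin \o (fun w : plane => r * h w)).
  by move=> ih; exact: (integrableZl measurable_square r ih).
congr (_ +i* _).
- rewrite -!RintegralZl; do ?exact: measurable_square; do ?by [].
  rewrite -[RHS]RintegralB; do ?[exact: measurable_square|exact: iZ].
  by apply: eq_Rintegral => w _; case: (f w).
- rewrite -!RintegralZl; do ?exact: measurable_square; do ?by [].
  rewrite -[RHS]RintegralD; do ?[exact: measurable_square|exact: iZ].
  by apply: eq_Rintegral => w _; case: (f w) => u v /=; rewrite addrC.
Qed.

Lemma cintegral_sumZ (I : Type) (r : seq I) (c : I -> R[i]) (f : I -> plane -> R[i]) :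
  (forall i, bounded_measurable (f i)) ->
  cintegral lam2 square (fun w => \sum_(i <- r) c i * f i w) =
  \sum_(i <- r) c i * cintegral lam2 square (f i).
Proof.
move=> bf; elim: r => [|i r IHr].
  have -> : (fun w => \sum_(i <- [::]) c i * f i w) = cst 0.
    by apply/funext => w; rewrite big_nil.
  rewrite big_nil.
  by rewrite /cintegral !Rintegral_cst ?mul0r//; exact: measurable_square.
rewrite big_cons -IHr -cintegralZ// -cintegralD.
- by congr cintegral; apply/funext => w; rewrite big_cons.
- by apply: bounded_measurableM => //; exact: bounded_measurable_cst.
- exact: bounded_measurable_sumZ.
Qed.

End complex_integrals.

(** * Fourier inversion tested against finitely many points *)

Section fourier_duality.
Context {R : realType}.
Notation plane := (measurableTypeR R * measurableTypeR R)%type.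
Implicit Types (f : plane -> R[i]) (z w : plane) (n : int * int).

Definition wave n z : R[i] := expi (n.1%:~R * z.1 + n.2%:~R * z.2).

Definition freq M (q : ('I_M * 'I_M) * ('I_M * 'I_M)) : int * int :=
  (q.1.1%:Z - q.2.1%:Z, q.1.2%:Z - q.2.2%:Z).

Definition cfejer_mean M f z : R[i] :=
  fejer_mean M (fun w => complex.Re (f w)) z +i*
  fejer_mean M (fun w => complex.Im (f w)) z.

Lemma fejer2_waves M z w : (fejer2 M z w)%:C =
  \sum_q (M%:R ^- 2 * wave (freq M q) z) *
    expi (- ((freq M q).1%:~R * w.1 + (freq M q).2%:~R * w.2)).
Proof.
rewrite /fejer2 rmorphM /= !fejer_expi mulrACA -invfM -expr2 !pair_big /=.
rewrite big_distrlr /= pair_big /=.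
rewrite (reindex (fun q : ('I_M * 'I_M) * ('I_M * 'I_M) =>
  ((q.1.1, q.2.1), (q.1.2, q.2.2)))) /=; last first.
  exists (fun p : ('I_M * 'I_M) * ('I_M * 'I_M) =>
    ((p.1.1, p.2.1), (p.1.2, p.2.2))) => p _; by case: p => [[? ?] [? ?]].
rewrite mulr_sumr; apply: eq_bigr => q _.
rewrite -mulrA /wave -!expiD; congr (_ * expi _).
by rewrite /freq /=; ring.
Qed.

Lemma bounded_measurable_wave n :
  bounded_measurable (fun w => expi (- (n.1%:~R * w.1 + n.2%:~R * w.2)) : R[i]).
Proof.
apply: bounded_measurable_expi; apply: measurableT_comp => //.
by apply: measurable_funD; apply: measurable_funM.
Qed.

Lemma cfejer_meanE M f z : bounded_measurable f ->
  cfejer_mean M f z =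
  M%:R ^- 2 * \sum_q fourier_coef2 f (freq M q) * wave (freq M q) z.
Proof.
move=> bf.
have -> : cfejer_mean M f z = ((2 * pi) ^- 2)%:C *
    cintegral lam2 square (fun w => f w * (fejer2 M z w)%:C).
  rewrite /cintegral /cfejer_mean /fejer_mean.
  have -> (u s t : R) : u%:C * (s +i* t) = (u * s) +i* (u * t).
    by apply/eqP; rewrite eq_complex /= !mul0r subr0 addr0 !eqxx.
  congr (_ * _ +i* (_ * _)); apply: eq_Rintegral => w _.
    by case: (f w) => u v /=; rewrite mulr0 subr0.
  by case: (f w) => u v /=; rewrite mulr0 add0r.
have -> : (fun w => f w * (fejer2 M z w)%:C) = (fun w =>
    \sum_q (M%:R ^- 2 * wave (freq M q) z) *
    (f w * expi (- ((freq M q).1%:~R * w.1 + (freq M q).2%:~R * w.2)))).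
  apply/funext => w; rewrite fejer2_waves mulr_sumr.
  by apply: eq_bigr => q _; rewrite mulrCA.
rewrite cintegral_sumZ; last first.
  by move=> q; apply: bounded_measurableM => //; exact: bounded_measurable_wave.
rewrite !mulr_sumr; apply: eq_bigr => q _.
rewrite /fourier_coef2; move: ((2 * pi) ^- 2)%:C (cintegral _ _ _) => u v.
by ring.
Qed.

Lemma sum_coef_le f (J : finType) (h : J -> int * int) : injective h ->
  (\sum_j (Normc.normc (fourier_coef2 f (h j)))%:E <= A_norm2 f)%E.
Proof.
move=> hinj; apply: esum_ge; exists [set` [seq h j | j <- enum J]].
  by split; [exact: finite_seq|].
rewrite -fsbig_seq; last by rewrite map_inj_uniq ?enum_uniq.
by rewrite big_map big_enum.
Qed.

(** When the subtracted indices [q.2] are fixed, [freq] is injective in the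
    indices [q.1], so each of the [M ^ 2] slices is at most the norm. *)
Lemma sum_freq_coef_le M f (A : R) : (A_norm2 f <= A%:E)%E ->
  \sum_(q : ('I_M * 'I_M) * ('I_M * 'I_M))
    Normc.normc (fourier_coef2 f (freq M q)) <= M%:R ^+ 2 * A.
Proof.
move=> fA; rewrite -(pair_big xpredT xpredT (fun k l : 'I_M * 'I_M =>
  Normc.normc (fourier_coef2 f (freq M (k, l))))) /= exchange_big /=.
apply: (@le_trans _ _ (\sum_(l : 'I_M * 'I_M) A)); last first.
  by rewrite sumr_const card_prod card_ord -[A *+ _]mulr_natl natrM expr2.
apply: ler_sum => l _; rewrite -lee_fin; apply: le_trans fA.
rewrite -sumEFin; apply: (sum_coef_le f _ (fun k => freq M (k, l))).
move=> [k1 k2] [k1' k2'] /= [/addIr[e1] /addIr[e2]].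
by congr (_, _); exact: val_inj.
Qed.

(** The Fejer means are finite combinations of waves, so the estimate of the
    functional on waves transfers to them without summing any series. *)
Lemma cfejer_mean_dual (I : finType) (c : I -> R[i]) (z : I -> plane) f (A C : R) M :
  (0 < M)%N -> bounded_measurable f -> (A_norm2 f <= A%:E)%E -> 
  (forall n, `|\sum_i c i * wave n (z i)| <= C%:C) ->
  `|\sum_i c i * cfejer_mean M f (z i)| <= (C * A)%:C.
Proof.
move=> M0 bf fA hC.
under eq_bigr do rewrite cfejer_meanE// mulrCA mulr_sumr.
rewrite -mulr_sumr exchange_big /= normrM normfV.
rewrite (ger0_norm (exprn_ge0 _ (ler0n _ _))).
have M2 : 0 < M%:R ^+ 2 :> R[i] by rewrite exprn_gt0// ltr0n.
rewrite ler_pdivrMl//; apply: le_trans (ler_norm_sum _ _ _) _.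
apply: (@le_trans _ _ (\sum_q (Normc.normc (fourier_coef2 f (freq M q)) * C)%:C)).
  apply: ler_sum => q _.
  under eq_bigr do rewrite mulrCA.
  rewrite -mulr_sumr normrM rmorphM /=.
  by apply: ler_pM => //; exact: hC.
rewrite -rmorph_sum -mulr_suml.
have -> : M%:R ^+ 2 * (C * A)%:C = (M%:R ^+ 2 * A * C)%:C :> R[i].
  by rewrite !rmorphM /= !rmorph_nat; ring.
rewrite lecR ler_wpM2r//; last exact: sum_freq_coef_le.
by rewrite -ler0c (le_trans (normr_ge0 _) (hC (0, 0))).
Qed.

Lemma continuous_box (g : R * R -> R) (z : R * R) (e : R) :
  {for z, continuous g} -> 0 < e -> exists2 d, 0 < d &
  forall w : R * R, `|z.1 - w.1| < d -> `|z.2 - w.2| < d -> `|g w - g z| <= e.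
Proof.
move=> /cvgrPdist_le/(_ _)/[apply]/nbhs_ballP[d /= d0 gd]; exists d => // w w1 w2.
by rewrite distrC; apply: gd; split.
Qed.

Lemma cfejer_mean_near f z (e : R) :
  measurable_fun (setT : set plane) (fun w => complex.Re (f w)) ->
  measurable_fun (setT : set plane) (fun w => complex.Im (f w)) ->
  (forall w, `|complex.Re (f w)| <= 1) -> (forall w, `|complex.Im (f w)| <= 1) ->
  {for (z : R * R), continuous (fun w : R * R => complex.Re (f w))} ->
  {for (z : R * R), continuous (fun w : R * R => complex.Im (f w))} ->
  `|z.1| < pi -> `|z.2| < pi -> 0 < e ->
  exists K : R, forall M, (0 < M)%N ->
    `|f z - cfejer_mean M f z| <= (e + K / M%:R)%:C.
Proof.
move=> mR mI R1 I1 cR cI z1 z2 e0; have e20 : 0 < e / 2 by rewrite divr_gt0.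
have [d d0 dR] := continuous_box _ _ _ cR e20.
have [d' d'0 dI] := continuous_box _ _ _ cI e20.
have [K hK] := fejer_mean_near _ z _ _ mR R1 z1 z2 e20 d0 dR.
have [K' hK'] := fejer_mean_near _ z _ _ mI I1 z1 z2 e20 d'0 dI.
exists (K + K') => M M0; rewrite distrC.
have -> : cfejer_mean M f z - f z =
    (fejer_mean M (fun w => complex.Re (f w)) z - complex.Re (f z))%:C +
    'i * (fejer_mean M (fun w => complex.Im (f w)) z - complex.Im (f z))%:C.
  by rewrite /cfejer_mean; case: (f z) => u v /=; simpc.
apply: le_trans (ler_normD _ _) _.
have normi : `|'i%C| = 1 :> R[i] by rewrite normc_def /= expr0n expr1n add0r sqrtr1.
have normR (r : R) : `|r%:C| = `|r|%:C :> R[i].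
  by rewrite normc_def /= expr0n addr0 sqrtr_sqr.
rewrite normrM normi mul1r !normR -rmorphD lecR.
have -> : e + (K + K') / M%:R = (e / 2 + K / M%:R) + (e / 2 + K' / M%:R) by lra.
by apply: lerD; [exact: hK|exact: hK'].
Qed.

(** Duality: a finitely supported measure whose Fourier transform is bounded by
    [C] acts on [f] with norm at most [C] times the Wiener norm of [f]. This is
    the only information on the Wiener norm that the lower bound uses.
    It holds for the Fejer means of [f], and they converge to [f] at the
    finitely many points concerned. *)
Lemma fourier_dual (I : finType) (c : I -> R[i]) (z : I -> plane) f (A C : R) :
  measurable_fun (setT : set plane) (fun w => complex.Re (f w)) ->
  measurable_fun (setT : set plane) (fun w => complex.Im (f w)) ->
  (forall w, `|complex.Re (f w)| <= 1) -> (forall w, `|complex.Im (f w)| <= 1) ->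
  continuous (fun w : R * R => complex.Re (f w)) ->
  continuous (fun w : R * R => complex.Im (f w)) ->
  (forall i, `|(z i).1| < pi) -> (forall i, `|(z i).2| < pi) ->
  (A_norm2 f <= A%:E)%E ->
  (forall n, `|\sum_i c i * wave n (z i)| <= C%:C) ->
  `|\sum_i c i * f (z i)| <= (C * A)%:C.
Proof.
move=> mR mI R1 I1 cR cI z1 z2 fA hC.
have normE (x : R[i]) : `|x| = (Normc.normc x)%:C by [].
rewrite normE lecR; apply/ler_addgt0Pr => e e0.
set S := \sum_i Normc.normc (c i).
have nc0 (x : R[i]) : 0 <= Normc.normc x by rewrite -lecR -normE normr_ge0.
have S0 : 0 <= S by apply: sumr_ge0.
have e'0 : 0 < e / (2 * (S + 1)).
  by rewrite divr_gt0// mulr_gt0// (le_lt_trans S0)// ltrDl.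
set e' := e / _ in e'0.
have /choice[K hK] : forall i, exists K : R, forall M, (0 < M)%N ->
    `|f (z i) - cfejer_mean M f (z i)| <= (e' + K / M%:R)%:C.
  by move=> i; apply: cfejer_mean_near => //; [exact: cR|exact: cI].
(* One order [M] large enough for all the points at once. *)
pose M := (Num.truncn ((\sum_i `|K i|) / e')).+1.
have M0 : (0 < M)%N by [].
have KM i : K i / M%:R <= e'.
  rewrite ler_pdivrMr ?ltr0n// mulrC -ler_pdivrMr//.
  apply: le_trans (ltW (truncnS_gt _)).
  rewrite ler_pM2r ?invr_gt0// (le_trans (ler_norm _))//.
  by rewrite (bigD1 i)//= lerDl sumr_ge0.
have bf : bounded_measurable f by exists 1; split.
have := cfejer_mean_dual _ c z _ _ _ _ M0 bf fA hC.
rewrite normE lecR => dual.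
rewrite -lecR -normE -(subrK (\sum_i c i * cfejer_mean M f (z i))
  (\sum_i c i * f (z i))).
apply: le_trans (ler_normD _ _) _; rewrite addrC rmorphD /= lerD//.
  by rewrite normE lecR.
rewrite -sumrB; apply: le_trans (ler_norm_sum _ _ _) _.
apply: (@le_trans _ _ (\sum_i (Normc.normc (c i) * (2 * e'))%:C)).
  apply: ler_sum => i _; rewrite -mulrBr normrM rmorphM /=.
  apply: ler_pM => //; apply: le_trans (hK i M M0) _.
  by rewrite lecR mulr2n mulrDl !mul1r lerD2l.
rewrite -rmorph_sum -mulr_suml lecR -/S /e'.
have -> : S * (2 * (e / (2 * (S + 1)))) = e * (S / (S + 1)).
  by field; rewrite gt_eqF// (le_lt_trans S0)// ltrDl.
by rewrite ger_pMr// ler_pdivrMr ?mul1r ?lerDl// (le_lt_trans S0)// ltrDl.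
Qed.

End fourier_duality.

(** * Orthogonality on a finite cyclic group *)

Section discrete_fourier.
Context {R : realType}.

Lemma expi_neq1 (t : R) : 0 < `|t| -> `|t| < 2 * pi -> expi t != 1 :> R[i].
Proof.
move=> t0 t2; have pi0 := @pi_gt0 R.
pose r := Num.min `|t| (2 * pi - `|t|).
have r0 : 0 < r by rewrite lt_min t0 subr_gt0.
have rt : r <= `|t| by rewrite ge_min lexx.
have tr : r <= 2 * pi - `|t| by rewrite ge_min lexx orbT.
have rpi : r <= pi by lra.
apply/eqP => -[ct _].
have : cos t <= cos r by apply: cos_le_cos => //; lra.
by have := one_sub_cos_gt0 _ r0 rpi; rewrite ct; lra.
Qed.

Lemma sum_roots_of_unity N (d : int) : (0 < N)%N -> (`|d| < N)%N ->
  \sum_(j < N) expi (d%:~R * (2 * pi / N%:R * j%:R)) =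
  if d == 0 then N%:R else 0 :> R[i].
Proof.
move=> N0 dN; have N0' : 0 < N%:R :> R by rewrite ltr0n.
have [->|d0] := eqVneq d 0.
  under eq_bigr do rewrite mul0r expi0.
  by rewrite sumr_const card_ord.
pose om : R[i] := expi (d%:~R * (2 * pi / N%:R)).
have omX (j : nat) : expi (d%:~R * (2 * pi / N%:R * j%:R)) = om ^+ j.
  by rewrite -expi_natM; congr expi; ring.
under eq_bigr do rewrite omX.
have omN : om ^+ N = 1.
  rewrite -omX -(expi_2pi d); congr expi; field.
  by rewrite gt_eqF.
have om1 : om != 1.
  have normd : `|d%:~R| = `|d|%N%:R :> R by rewrite -intr_norm.
  have pi0 := @pi_gt0 R.
  have c0 : 0 < 2 * pi / N%:R :> R by rewrite divr_gt0// mulr_gt0.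
  apply: expi_neq1; rewrite normrM normd (gtr0_norm c0).
    by rewrite mulr_gt0// ltr0n absz_gt0.
  by rewrite mulrA ltr_pdivrMr// mulrC ltr_pM2l ?ltr_nat// mulr_gt0.
have := subrX1 om N; rewrite omN subrr => /esym/eqP.
by rewrite mulf_eq0 subr_eq0 (negbTE om1) => /eqP.
Qed.

(** Parseval over the [N] translates of the Dirichlet kernel: off-diagonal pairs
    [(k, l)] cancel because [k - l] is not a multiple of [N]. The value does not
    depend on [t], which makes the final estimate uniform in the frequency. *)
Lemma sum_sqr_dirichlet N (t : R) : (0 < N)%N ->
  \sum_(j < N) `|\sum_(k < N) expi (k%:R * (t - 2 * pi / N%:R * j%:R))| ^+ 2 =
  N%:R ^+ 2 :> R[i].
Proof.
move=> N0; under eq_bigr do rewrite sqr_norm_sum_expi.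
rewrite exchange_big /=.
transitivity (\sum_(k < N) (N%:R : R[i])); last first.
  by rewrite sumr_const card_ord expr2 mulr_natl.
apply: eq_bigr => k _; rewrite exchange_big /= (bigD1 k)//=.
rewrite [X in _ + X]big1 ?addr0 => [|l lk].
  under eq_bigr do rewrite subrr mul0r expi0.
  by rewrite sumr_const card_ord.
transitivity (\sum_(j < N) expi ((k%:Z - l%:Z)%:~R * t) *
    (expi ((l%:Z - k%:Z)%:~R * (2 * pi / N%:R * j%:R)) : R[i])).
  by apply: eq_bigr => j _; rewrite -expiD; congr expi; rewrite !intrB; ring.
rewrite -mulr_sumr sum_roots_of_unity//; last first.
  by have := ltn_ord k; have := ltn_ord l; lia.
by rewrite subr_eq0 eqz_nat [_ == _](negbTE lk) mulr0.
Qed.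

End discrete_fourier.

(** * Values of a continuous periodic function *)

Section real_functions.
Context {R : realType}.

Lemma periodic_int (f : R -> R) (T x : R) (m : int) :
  periodic f T -> f (x + m%:~R * T) = f x.
Proof.
move=> pf; case: m => n; first by rewrite mulr_natl periodicn.
rewrite NegzE rmorphN mulNr mulr_natl -(periodicn pf n.+1).
by rewrite subrK.
Qed.

(** A point congruent to [pi] has no representative in the open interval, so
    values are only approximated there; this is enough to keep two of them
    distinct. *)
Lemma periodic_approx_pi (f : R -> R) (x e : R) :
  periodic f (2 * pi) -> continuous f -> 0 < e ->
  exists2 x', `|x'| < pi & `|f x - f x'| < e.
Proof.
move=> pf cf e0; have pi0 := @pi_gt0 R.
have pi20 : 0 < 2 * pi :> R by rewrite mulr_gt0.
pose m := Num.floor ((x + pi) / (2 * pi)).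
pose x0 := x - m%:~R * (2 * pi).
have fx0 : f x0 = f x by rewrite /x0 -mulNr -rmorphN periodic_int.
have /andP[x0l x0r] : - pi <= x0 < pi.
  have := floor_itv ((x + pi) / (2 * pi)); rewrite -/m.
  by rewrite ler_pdivlMr// ltr_pdivrMr// intrD /x0; lra.
have /cvgrPdist_lt/(_ _ e0)/nbhs_ballP[d /= d0 fd] := cf x0.
pose s := Num.min (d / 2) ((pi - x0) / 2).
have s0 : 0 < s by rewrite lt_min !divr_gt0// subr_gt0.
have sd : s <= d / 2 by rewrite ge_min lexx.
have sx : s <= (pi - x0) / 2 by rewrite ge_min lexx orbT.
exists (x0 + s); first by rewrite ltr_norml; apply/andP; split; lra.
rewrite -fx0; apply: fd; rewrite /ball /= opprD addrA subrr sub0r normrN gtr0_norm//.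
lra.
Qed.

Lemma periodic_nonconst_pi (f : R -> R) :
  periodic f (2 * pi) -> continuous f -> (exists x1 x2, f x1 <> f x2) ->
  exists x1 x2, [/\ `|x1| < pi, `|x2| < pi & f x1 != f x2].
Proof.
move=> pf cf [x1 [x2 /eqP f12]].
have e0 : 0 < `|f x1 - f x2| / 2 by rewrite divr_gt0// normr_gt0 subr_eq0.
have [x1' x1pi f1] := periodic_approx_pi _ x1 _ pf cf e0.
have [x2' x2pi f2] := periodic_approx_pi _ x2 _ pf cf e0.
exists x1', x2'; split => //; apply/eqP => f12'.
have := ler_distD (f x1') (f x1) (f x2).
have -> : `|f x1' - f x2| = `|f x2 - f x2'| by rewrite f12' distrC.
lra.
Qed.

Lemma intermediate_value_pi (f : R -> R) (x1 x2 s : R) : continuous f ->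
  `|x1| < pi -> `|x2| < pi -> 0 <= s <= 1 ->
  exists2 x, `|x| < pi & f x = f x1 + s * (f x2 - f x1).
Proof.
move=> cf; wlog x12 : x1 x2 s / x1 <= x2 => [IH|].
  have [x12|/ltW x21] := leP x1 x2; first exact: IH.
  move=> h1 h2 /andP[s0 s1].
  have [|x xpi fx] := IH x2 x1 (1 - s) x21 h2 h1.
    by rewrite subr_ge0 s1 lerBlDr lerDl.
  by exists x => //; rewrite fx; ring.
rewrite !ltr_norml => /andP[h1 h1'] /andP[h2 h2'] /andP[s0 s1].
have [|//||x] := @IVT _ f x1 x2 (f x1 + s * (f x2 - f x1)).
- by [].
- exact: continuous_subspaceT.
- rewrite ge_min le_max; case: (leP (f x1) (f x2)) => f12.
    by nra.
  by nra.
rewrite in_itv /= => /andP[xl xr] fx; exists x => //.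
by rewrite ltr_norml; apply/andP; split; lra.
Qed.

Lemma continuous_complex_real (f : R -> R) :
  continuous ((fun x => (f x)%:C) : R -> R[i]^o) -> continuous f.
Proof.
move=> cf x; apply/cvgrPdist_lt => e e0.
have e0' : 0 < e%:C :> R[i] by rewrite ltcR.
have /cvgrPdist_lt/(_ _ e0') := cf x.
apply: filterS => y.
have normR (r : R) : `|r%:C| = `|r|%:C :> R[i].
  by rewrite normc_def /= expr0n addr0 sqrtr_sqr.
by rewrite -rmorphB normR ltcR.
Qed.

End real_functions.

(** * The extremal grid *)

Section lower_bound.
Context {R : realType}.
Notation plane := (measurableTypeR R * measurableTypeR R)%type.

(** On the grid [(x j, y0 + (k - l) * h)] the function is, up to unimodular factors
    each depending on [j] alone or on [k - l] alone, the character
    [expi (2 * pi * j * (k - l) / N)] of the cyclic group of order [N]. The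
    points are indexed by triples [(j, k, l)], each weighted by the conjugate of
    the value there, so that the function itself is sent to [N ^ 3]. On a wave
    the sum over [(k, l)] is a squared Dirichlet kernel at a point that moves by
    [2 * pi / N] with [j]; it is nonnegative, hence the unknown phases coming from
    [x j] cost nothing, and [sum_sqr_dirichlet] bounds the whole by [N ^ 2].
    Repeating each height as many times as [k - l] takes its value yields the
    Fejer weights, without which the sums over [j] would grow by a logarithm. *)
Lemma A_norm2_ge_grid (N : nat) (lambda p q y0 h t0 delta : R) (a b : R -> R)
    (x : 'I_N -> R) :
  (0 < N)%N -> continuous a -> continuous b ->
  (forall j, `|x j| < pi) -> (forall j, a (x j) = t0 + delta * j%:R) ->
  (forall r : int, (`|r| < N)%N -> `|y0 + r%:~R * h| < pi) ->
  (forall r : int, (`|r| < N)%N ->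
     b (y0 + r%:~R * h) = p * (y0 + r%:~R * h) + q) ->
  lambda * p * h * delta = 2 * pi / N%:R ->
  (N%:R%:E <= A_norm2 (fun z : R * R => expi (lambda * (a z.1 * b z.2))))%E.
Proof.
move=> N0 ca cb xpi ax ypi by_ phase.
set f : R * R -> R[i] := fun z => expi (lambda * (a z.1 * b z.2)).
case fA : (A_norm2 f) => [A| |]; last 2 first.
- exact: leey.
- have : (0 <= A_norm2 f)%E.
    apply: esum_ge0 => n _; rewrite lee_fin -lecR.
    exact: (normr_ge0 (fourier_coef2 f n)).
  by rewrite fA.
have N0' : 0 < N%:R :> R by rewrite ltr0n.
pose u (z : plane) : R := lambda * (a z.1 * b z.2).
have mu : measurable_fun setT u.
  apply: measurable_funM => //; apply: measurable_funM.
    by apply: (measurableT_comp (continuous_measurable_fun ca)).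
  by apply: (measurableT_comp (continuous_measurable_fun cb)).
have cu : continuous (u : R * R -> R).
  move=> z; apply: cvgM; first exact: cvg_cst.
  apply: cvgM.
    by apply: (@continuous_comp _ _ _ fst a); [exact: cvg_fst|exact: ca].
  by apply: (@continuous_comp _ _ _ snd b); [exact: cvg_snd|exact: cb].
have [_ [mR mI _ _]] := bounded_measurable_expi _ mu.
pose r (i : 'I_N * ('I_N * 'I_N)) : int := i.2.1%:Z - i.2.2%:Z.
have rN i : (`|r i| < N)%N.
  by rewrite /r; have := ltn_ord i.2.1; have := ltn_ord i.2.2; lia.
pose z i : plane := (x i.1, y0 + (r i)%:~R * h).
have := @fourier_dual _ _ (fun i => expi (- u (z i))) z f A (N%:R ^+ 2) mR mI.
have main n : `|\sum_i expi (- u (z i)) * wave n (z i)| <= (N%:R ^+ 2)%:C.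
  (* [v j] carries every phase independent of the height. *)
  pose v (j : 'I_N) : R[i] := expi (n.1%:~R * x j + n.2%:~R * y0
     - lambda * (a (x j) * (p * y0 + q))).
  pose th : R := n.2%:~R * h - lambda * p * h * t0.
  have -> : \sum_i expi (- u (z i)) * wave n (z i) = \sum_(j < N) v j *
      `|\sum_(k < N) expi (k%:R * (th - 2 * pi / N%:R * j%:R))| ^+ 2.
    rewrite -(pair_big xpredT xpredT
      (fun j i => expi (- u (z (j, i))) * wave n (z (j, i)))) /=.
    apply: eq_bigr => j _; rewrite sqr_norm_sum_expi mulr_sumr.
    rewrite -(pair_big xpredT xpredT
      (fun k l => expi (- u (z (j, (k, l)))) * wave n (z (j, (k, l))))) /=.
    apply: eq_bigr => k _; rewrite mulr_sumr; apply: eq_bigr => l _.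
    have := rN (j, (k, l)); rewrite /z /r /=; set s := k%:Z - l%:Z => sN.
    rewrite /u /wave /v -!expiD; congr expi; rewrite /= by_// -phase ax /th.
    ring.
  apply: le_trans (ler_norm_sum _ _ _) _.
  under eq_bigr do rewrite normrM norm_expi mul1r ger0_norm ?exprn_ge0//.
  by rewrite sum_sqr_dirichlet// rmorphXn /= rmorph_nat.
have -> : \sum_i expi (- u (z i)) * f (z i) = (N%:R ^+ 3)%:C.
  under eq_bigr do rewrite mulrC expiVN.
  rewrite sumr_const !card_prod card_ord rmorphXn /= rmorph_nat -natrX.
  by rewrite !expnS expn0 muln1.
rewrite ger0_norm; last by rewrite ler0c exprn_ge0// ltW.
move=> dual; rewrite lee_fin.
have : N%:R ^+ 3 <= N%:R ^+ 2 * A.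
  rewrite -lecR; apply: dual => //.
  - by move=> w; exact: cos_max.
  - by move=> w; exact: sin_max.
  - by move=> w; apply: (@continuous_comp _ _ _ (u : R * R -> R) cos);
      [exact: cu|exact: continuous_cos].
  - by move=> w; apply: (@continuous_comp _ _ _ (u : R * R -> R) sin);
      [exact: cu|exact: continuous_sin].
  - by move=> i; exact: xpi.
  - by move=> i; exact: (ypi _ (rN i)).
  - by rewrite fA.
by rewrite exprSr ler_pM2l// exprn_gt0.
Qed.

End lower_bound.

Theorem corollary1 (R : realType) (a b : R -> R)
  (ha : in_A1 (fun x : R => (a x)%:C))
  (hb : in_A1 (fun y : R => (b y)%:C))
  (a_nonconst : exists x1 x2 : R, a x1 <> a x2)
  (b_nonconst : exists y1 y2 : R, b y1 <> b y2)
  (b_linear : exists u v p q : R,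
     [/\ u < v, `]u, v[ `<=` `[- pi, pi], p <> 0 &
         forall y : R, y \in `]u, v[ -> b y = p * y + q]) :
  exists c lambda0 : R,
    [/\ 0 < c, 0 < lambda0 &
        forall lambda : R, lambda0 <= `|lambda| ->
          ((c * `|lambda|)%:E <=
             A_norm2 (fun z : R * R => expi (lambda * (a z.1 * b z.2))))%E].
Proof.
have [a_per /continuous_complex_real ca _] := ha.
have [_ /continuous_complex_real cb _] := hb.
have {}a_per : periodic a (2 * pi) by move=> x; apply: complexI; exact: a_per.
have [x1 [x2 [x1pi x2pi a12]]] := periodic_nonconst_pi _ a_per ca a_nonconst.
have [u [v [p [q [uv uvpi /eqP p0 b_lin]]]]] := b_linear.
have pi0 := @pi_gt0 R.
pose D := a x2 - a x1.
have D0 : D != 0 by rewrite subr_eq0 eq_sym.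
have pD0 : 0 < `|p * D| by rewrite normr_gt0 mulf_neq0.
(* The grid has steps [D / N] in the values of [a] and [h] in the variable [y];
   requiring [lambda * p * h * (D / N) = 2 * pi / N] leaves no freedom for [h], and
   the heights stay in the interval if [N - 1 <= kappa * |lambda|]. *)
pose kappa := (v - u) * `|p * D| / (8 * pi).
have kappa0 : 0 < kappa by rewrite divr_gt0 ?mulr_gt0// subr_gt0.
exists kappa, 1; split => // lambda lambda1.
have l0 : 0 < `|lambda| by rewrite (lt_le_trans ltr01).
have l_neq0 : lambda != 0 by rewrite -normr_gt0.
pose N := (Num.truncn (kappa * `|lambda|)).+1.
have N0 : 0 < N%:R :> R by rewrite ltr0n.
apply: (@le_trans _ _ N%:R%:E); first by rewrite lee_fin ltW// truncnS_gt.
pose h := 2 * pi / (lambda * p * D).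
pose y0 := (u + v) / 2.
have grid (r : int) : (`|r| < N)%N -> y0 + r%:~R * h \in `]u, v[.
  move=> rN; have rk : `|r%:~R| <= kappa * `|lambda| :> R.
    rewrite -intr_norm -[`|r|]/(`|r|%N%:Z).
    have : 0 <= kappa * `|lambda| by rewrite mulr_ge0// ltW.
    rewrite -truncn_le; apply: le_trans.
    by rewrite -pmulrn ler_nat -ltnS.
  have : `|r%:~R * h| < (v - u) / 2.
    rewrite normrM; apply: (@le_lt_trans _ _ (kappa * `|lambda| * `|h|)).
      by rewrite ler_wpM2r.
    have -> : kappa * `|lambda| * `|h| = (v - u) / 4.
      rewrite /kappa /h normf_div -(mulrA lambda) (normrM lambda).
      rewrite [`|2 * pi|]gtr0_norm ?mulr_gt0//.
      by move: (@pi R) (lt0r_neq0 pi0) => P P0; field; rewrite P0 !gt_eqF.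
    by rewrite ltr_pM2l ?subr_gt0// ltf_pV2 ?posrE// ltr_nat.
  rewrite ltr_norml in_itv /= /y0 => /andP[h1 h2].
  by apply/andP; split; lra.
have interior (y : R) : y \in `]u, v[ -> `|y| < pi.
  rewrite in_itv /= => /andP[uy yv]; rewrite ltr_norml.
  have /uvpi : `]u, v[%classic ((u + y) / 2) by rewrite /= in_itv /=; apply/andP; split; lra.
  have /uvpi : `]u, v[%classic ((y + v) / 2) by rewrite /= in_itv /=; apply/andP; split; lra.
  rewrite /= !in_itv /= => /andP[h1 h2] /andP[h3 h4].
  by apply/andP; split; lra.
have /choice[x xP] : forall j : 'I_N, exists x, `|x| < pi /\ a x = a x1 + D / N%:R * j%:R.
  move=> j; have [|x xpi ax] := @intermediate_value_pi _ a x1 x2 (j%:R / N%:R) ca x1pi x2pi.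
    rewrite divr_ge0//= ler_pdivrMr// mul1r ler_nat.
    exact: ltnW.
  by exists x; split => //; rewrite ax /D; ring.
apply: (@A_norm2_ge_grid _ _ _ p q y0 h (a x1) (D / N%:R) _ _ x) => //.
- by move=> j; have [] := xP j.
- by move=> j; have [] := xP j.
- by move=> r /grid/interior.
- by move=> r /grid; exact: b_lin.
- by rewrite /h; move: (@pi R) => P; field; rewrite p0 l_neq0 D0 gt_eqF.
Qed.
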